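(* Let $n\ge 1$, let $x_1,\dots,x_n\in\mathbb{C}\setminus\{0\}$ be computable numbers and $M\in\mathbb{Q}$ such that the lattice \[ L_+=\Bigl\{(e_1,\dots,e_n)\in\mathbb{Z}^n \;\Big|\; \sum_{i=1}^n e_ix_i=0\Bigr\} \] has a basis consisting of vectors $b\in\mathbb{Z}^n$ with $\lVert b\rVert_\infty\le M$, and suppose that one can decide for any $b\in\mathbb{Z}^n$ whether $b\in L_+$. Then the lattice algorithm described in the context, run on the input $x_1,\dots,x_n,M$, terminates and its output is a basis of $L_+$.
   Context: A lattice is a $\mathbb{Z}$-submodule of some $\mathbb{Z}^N$; a basis is a linearly independent generating set. $\lVert\cdot\rVert_2$ is the Euclidean norm. Computable means that for every $\epsilon>0$ one can compute $\xi_1,\dots,\xi_n\in\mathbb{Q}(\mathrm{i})$ with $|\Re(x_i)-\Re(\xi_i)|<\epsilon$ and $|\Im(x_i)-\Im(\xi_i)|<\epsilon$ for all $i$. LLL: applied to a linearly independent set of vectors, the LLL algorithm outputs a basis $b_1,\dots,b_r$ (called reduced) of the lattice they generate such that, with $\bar b_1,\dots,\bar b_r$ the Gram-Schmidt vectors (orthogonalized, not normalized) of $b_1,\dots,b_r$, one has $\lVert b_j\rVert_2^2\le 2^{k-1}\lVert\bar b_k\rVert_2^2$ for all $1\le j\le k\le r$. The algorithm: 1. Set $w\leftarrow1$. 2. Set $B\leftarrow\{(1,0,\dots,0,0,0),\dots,(0,\dots,0,1,0,0)\}$, the first $n$ unit vectors of length $n+2$. 3. While there is $(e_1,\dots,e_n,\ast,\ast)\in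 B$ with $(e_1,\dots,e_n)\notin L_+$, do: (a) $w\leftarrow2w$; (b) find $\xi_1,\dots,\xi_n\in\mathbb{Q}(\mathrm{i})$ with $|\Re(\xi_i)-\Re(x_i)|<\frac1{nw}$ and $|\Im(\xi_i)-\Im(x_i)|<\frac1{nw}$ for all $i=1,\dots,n$; (c) replace every vector $(e_1,\dots,e_n,\ast,\ast)\in B$ by $\bigl(e_1,\dots,e_n,\,w\sum_{i=1}^ne_i\Re(\xi_i),\,w\sum_{i=1}^ne_i\Im(\xi_i)\bigr)$; (d) apply LLL to $B$, call the output vectors $b_1,\dots,b_r$ and the corresponding Gram-Schmidt vectors $\bar b_1,\dots,\bar b_r$; (e) while $r>0$ and $\lVert\bar b_r\rVert_2>\sqrt{n+2}\,M$, set $r\leftarrow r-1$; (f) $B\leftarrow\{b_1,\dots,b_r\}$. 4. Return $\{(e_1,\dots,e_n) : (e_1,\dots,e_n,\ast,\ast)\in B\}$. Here $\ast$ denotes arbitrary entries. *)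

(* Defs.v *)
(* R : realType models the reals, R[i] the complex numbers, and rat[i], used
   only as a type of pairs (Re, Im), models Q(i). *)
From mathcomp Require Import all_boot all_order all_algebra.
From mathcomp Require Import reals.
From mathcomp.real_closed Require Import complex.

Set Implicit Arguments.
Unset Strict Implicit.
Unset Printing Implicit Defensive.

Import Order.TTheory GRing.Theory Num.Theory.

Local Open Scope ring_scope.
Local Open Scope complex_scope.

(* Computability: mu-recursive functions of a list of natural numbers. *)
Inductive murec : Type :=
| MZero
| MSucc
| MProj of nat
| MComp of murec & seq murec
| MRec of murec & murec
| MMin of murec.

Inductive mueval : murec -> seq nat -> nat -> Prop :=
| EvZero v : mueval MZero v 0%N
| EvSucc a v : mueval MSucc (a :: v) a.+1
| EvProj i v : (i < size v)%N -> mueval (MProj i) v (nth 0%N v i)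
| EvComp f gs v ws y :
    size ws = size gs ->
    (forall i, (i < size gs)%N -> mueval (nth MZero gs i) v (nth 0%N ws i)) ->
    mueval f ws y -> mueval (MComp f gs) v y
| EvRec0 f g v y : mueval f v y -> mueval (MRec f g) (0%N :: v) y
| EvRecS f g k v r y :
    mueval (MRec f g) (k :: v) r -> mueval g [:: k, r & v] y ->
    mueval (MRec f g) (k.+1 :: v) y
| EvMin f v m :
    (forall k, (k < m)%N -> exists r, mueval f (k :: v) r.+1) ->
    mueval f (m :: v) 0%N -> mueval (MMin f) v m.

(* Data are coded by the library's injections pickle into nat, which are
   effective on the types used here (built from nat by sums and sequences). *)
Definition computable_fun (A B : countType) (f : A -> B) : Prop :=
  exists p : murec, forall a : A, mueval p [:: pickle a] (pickle (f a)).

(* A precision is a rational eps > 0, so that it can be given as input. *)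
Definition computes_numbers (R : realType) (n : nat) (x : 'I_n -> R[i])
    (approx : rat -> {ffun 'I_n -> rat[i]}) : Prop :=
  computable_fun approx /\
  forall (eps : rat) (i : 'I_n), 0 < eps ->
    `|complex.Re (x i) - ratr (complex.Re (approx eps i))| < ratr eps /\
    `|complex.Im (x i) - ratr (complex.Im (approx eps i))| < ratr eps.

Definition decides (n : nat) (L : 'rV[int]_n -> Prop)
    (inL : 'rV[int]_n -> bool) : Prop :=
  computable_fun inL /\ forall b, L b <-> inL b.

(* inIntSpan (in_tuple s) v: v is an integral combination of the entries of s. *)
Definition zfree (V : zmodType) (s : seq V) : Prop :=
  forall a : {ffun 'I_(size s) -> int},
    \sum_(i < size s) s`_i *~ a i = 0 -> forall i, a i = 0.

Definition is_zbasis (V : zmodType) (L : V -> Prop) (s : seq V) : Prop :=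
  zfree s /\ forall v, L v <-> inIntSpan (in_tuple s) v.

Definition Lplus (R : realType) (n : nat) (x : 'I_n -> R[i])
    (e : 'rV[int]_n) : Prop :=
  \sum_(i < n) (e 0 i)%:~R * x i = 0.

Definition norm_inf (n : nat) (b : 'rV[int]_n) : nat :=
  (\max_(i < n) `|b 0%R i|)%N.

Definition dot (N : nat) (u v : 'rV[rat]_N) : rat := \sum_(i < N) u 0 i * v 0 i.

Definition norm2 (R : realType) (N : nat) (u : 'rV[rat]_N) : R :=
  Num.sqrt (ratr (dot u u)).

(* Orthogonalized, not normalized. *)
Definition gram_schmidt (N : nat) (s : seq 'rV[rat]_N) : seq 'rV[rat]_N :=
  foldl (fun g v => rcons g (v - \sum_(u <- g) (dot v u / dot u u) *: u))
    [::] s.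

(* Indices start from 0, whence 2 ^+ k rather than 2 ^+ k.-1. *)
Definition lll_reduced (N : nat) (b : seq 'rV[rat]_N) : Prop :=
  forall j k : nat, (j <= k < size b)%N ->
    dot b`_j b`_j <= 2 ^+ k * dot (gram_schmidt b)`_k (gram_schmidt b)`_k.

Definition lll_spec (N : nat) (lll : seq 'rV[rat]_N -> seq 'rV[rat]_N) : Prop :=
  forall B, zfree B ->
    is_zbasis (inIntSpan (in_tuple B)) (lll B) /\ lll_reduced (lll B).

(* The vectors handled by the algorithm are rational, since their last two
   entries are; their first n entries are always integers, recovered by numq. *)
Definition epart (n : nat) (b : 'rV[rat]_(n + 2)) : 'rV[int]_n :=
  map_mx numq (lsubmx b).

Definition initial_vectors (n : nat) : seq 'rV[rat]_(n + 2) :=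
  [seq delta_mx 0 (lshift 2 i) | i <- enum 'I_n].

Definition refresh (n : nat) (w : nat) (xi : 'I_n -> rat[i])
    (b : 'rV[rat]_(n + 2)) : 'rV[rat]_(n + 2) :=
  row_mx (lsubmx b)
    (\row_(j < 2) [:: w%:R * \sum_(i < n) lsubmx b 0 i * complex.Re (xi i);
                      w%:R * \sum_(i < n) lsubmx b 0 i * complex.Im (xi i)]`_j).

(* The final value of r, starting from r, when r is decremented as long as
   r > 0 and the r-th vector of g has Euclidean norm > bound. *)
Fixpoint cut_index (R : realType) (N : nat) (bound : R)
    (g : seq 'rV[rat]_N) (r : nat) : nat :=
  if r is r'.+1 then
    if bound < norm2 R g`_r' then cut_index bound g r' else r
  else 0%N.

Definition loop_body (R : realType) (n : nat)
    (approx : rat -> {ffun 'I_n -> rat[i]})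
    (lll : seq 'rV[rat]_(n + 2) -> seq 'rV[rat]_(n + 2)) (M : rat)
    (w : nat) (B : seq 'rV[rat]_(n + 2)) : seq 'rV[rat]_(n + 2) :=
  let xi := approx (n%:R * w%:R)^-1 in
  let b := lll [seq refresh w xi v | v <- B] in
  let bound : R := Num.sqrt (n + 2)%:R * ratr M in
  take (cut_index bound (gram_schmidt b) (size b)) b.

(* None means that the loop is not finished after the given number of
   iterations; the result, if any, does not depend on that number. *)
Fixpoint run_loop (R : realType) (n : nat)
    (approx : rat -> {ffun 'I_n -> rat[i]}) (inL : 'rV[int]_n -> bool)
    (lll : seq 'rV[rat]_(n + 2) -> seq 'rV[rat]_(n + 2)) (M : rat)
    (fuel : nat) (w : nat) (B : seq 'rV[rat]_(n + 2)) :
    option (seq 'rV[int]_n) :=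
  if has (fun b => ~~ inL (epart b)) B then
    if fuel is fuel'.+1 then
      run_loop R approx inL lll M fuel' (2 * w)
        (loop_body R approx lll M (2 * w) B)
    else None
  else Some [seq epart b | b <- B].

Definition lattice_algorithm (R : realType) (n : nat)
    (approx : rat -> {ffun 'I_n -> rat[i]}) (inL : 'rV[int]_n -> bool)
    (lll : seq 'rV[rat]_(n + 2) -> seq 'rV[rat]_(n + 2)) (M : rat)
    (fuel : nat) : option (seq 'rV[int]_n) :=
  run_loop R approx inL lll M fuel 1 (initial_vectors n).

(* Main.v *)
Require Import Defs.
From HB Require Import structures.
From mathcomp Require Import all_boot all_order all_algebra.
From mathcomp Require Import reals.
From mathcomp.real_closed Require Import complex.
From mathcomp Require Import ring lra.

Set Implicit Arguments.
Unset Strict Implicit.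
Unset Printing Implicit Defensive.

Import Order.TTheory GRing.Theory Num.Theory.

Local Open Scope ring_scope.
Local Open Scope complex_scope.

(** Each vector handled by the loop is determined by its integral part e, the
first n entries: it is [lift w xi e], and [lift w xi] is additive and
injective. Hence the whole computation can be followed on integral parts, where
the lattice only changes when vectors are cut off. Two facts carry the proof.

Nothing in L_+ is lost. If e is in L_+ and its entries are at most M, the
approximations have error below 1 / (n w), so the last two entries of
[lift w xi e] are at most M in absolute value ([scaled_comb_error]) and its
norm is at most sqrt (n + 2) M ([norm2_lift_le]). A lattice vector whose
coefficient on the last basis vector is a nonzero integer is at least as long
as the last Gram-Schmidt vector ([dot_gram_schmidt_le]), so a basis vector cut
off by the algorithm has coefficient 0 in every such short vector
([zcomb_cut_index]). Since L_+ is generated by short vectors, it stays inside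
the lattice generated by the integral parts ([loop_inv_body]).

The loop stops. The reducedness of the LLL basis bounds all remaining vectors
by a constant multiple of the last remaining Gram-Schmidt vector, hence by a
constant D which does not depend on w ([dot_cut_index_le]). Thus the entries
of e are bounded, and |\sum_i e_i x_i| = O(1 / w). There are only finitely many
bounded integral vectors e, so the nonzero values of the sum stay away from 0
([small_comb_eq0]), and for w large all remaining e lie in L_+
([Lplus_of_dot_lift_le]). At that point the integral parts are independent,
belong to L_+ and generate it. *)

(** * Integral spans and independence *)

Notation zspan s := (inIntSpan (in_tuple s)).

(** Coefficients are indexed by nat rather than by an ordinal type, so that the
length of a combination can change without casts. *)
Definition zcomb (V : zmodType) (s : seq V) (r : nat) (a : nat -> int) : V :=
  \sum_(i < r) s`_i *~ a i.

Lemma ffun_ext_nat (T : Type) (x0 : T) m (a : {ffun 'I_m -> T}) :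
  exists c : nat -> T, forall i : 'I_m, c i = a i.
Proof.
exists (fun k => if insub k is Some j then a j else x0) => i.
by rewrite insubT // => lt_im; congr (a _); apply: val_inj.
Qed.

Lemma zspanP (V : zmodType) (s : seq V) v :
  zspan s v <-> exists a, v = zcomb s (size s) a.
Proof.
split=> [[a ->]|[a ->]].
  have [c Ec] := ffun_ext_nat 0 a; exists c.
  by apply: eq_bigr => i _; rewrite Ec.
by exists [ffun i => a (val i)]; apply: eq_bigr => i _; rewrite ffunE.
Qed.

Lemma zfreeP (V : zmodType) (s : seq V) :
  zfree s <-> forall a, zcomb s (size s) a = 0 ->
    forall i, (i < size s)%N -> a i = 0.
Proof.
split=> [free_s a a0 i lt_is|free_s a a0 i].
  have /(_ (Ordinal lt_is)): forall j, [ffun j : 'I_(size s) => a j] j = 0.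
    by apply: free_s; rewrite -[RHS]a0; apply: eq_bigr => j _; rewrite ffunE.
  by rewrite ffunE.
have [c Ec] := ffun_ext_nat 0 a; rewrite -Ec; apply: free_s => //.
by rewrite -[RHS]a0; apply: eq_bigr => j _; rewrite Ec.
Qed.

Lemma zcombD (V : zmodType) (s : seq V) r a b :
  zcomb s r (fun i => a i + b i) = zcomb s r a + zcomb s r b.
Proof. by rewrite -big_split; apply: eq_bigr => i _; rewrite mulrzDr. Qed.

Lemma zcombMz (V : zmodType) (s : seq V) r a c :
  zcomb s r (fun i => a i * c) = zcomb s r a *~ c.
Proof. by rewrite mulrz_suml; apply: eq_bigr => i _; rewrite mulrzA. Qed.

Lemma zcomb_map (V W : zmodType) (f : {additive V -> W}) (s : seq V) r a :
  (r <= size s)%N -> zcomb (map f s) r a = f (zcomb s r a).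
Proof.
move=> le_rs; rewrite raddf_sum; apply: eq_bigr => i _.
by rewrite raddfMz (nth_map 0) // (leq_trans _ le_rs).
Qed.

Lemma zcomb_take (V : zmodType) (s : seq V) r a :
  zcomb (take r s) r a = zcomb s r a.
Proof. by apply: eq_bigr => i _; rewrite nth_take. Qed.

Lemma zcomb_recr (V : zmodType) (s : seq V) r a :
  zcomb s r.+1 a = zcomb s r a + s`_r *~ a r.
Proof. exact: big_ord_recr. Qed.

Lemma zcomb_widen (V : zmodType) (s : seq V) r t a : (r <= t)%N ->
  zcomb s t (fun i => if (i < r)%N then a i else 0) = zcomb s r a.
Proof.
move=> le_rt; rewrite /zcomb (big_ord_widen _ (fun i => s`_i *~ a i) le_rt).
by rewrite [RHS]big_mkcond; apply: eq_bigr => i _; case: ifP.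
Qed.

Lemma zspan_mem (V : zmodType) (s : seq V) v : v \in s -> zspan s v.
Proof.
move=> s_v; apply/zspanP; have lt_vs: (index v s < size s)%N by rewrite index_mem.
exists (fun i => (i == index v s)%:Z).
rewrite /zcomb (bigD1 (Ordinal lt_vs)) //= eqxx mulr1z nth_index // big1 ?addr0 //.
by move=> i /negPf ne_iv; rewrite -val_eqE /= in ne_iv; rewrite ne_iv mulr0z.
Qed.

Lemma zspan_trans (V : zmodType) (s t : seq V) v :
  (forall u, u \in s -> zspan t u) -> zspan s v -> zspan t v.
Proof.
move=> s_t /zspanP[a ->]; rewrite /zcomb.
apply: big_ind => [|u w /zspanP[b ->] /zspanP[c ->]|i _].
- by apply/zspanP; exists (fun=> 0); rewrite /zcomb big1 // => i _; rewrite mulr0z.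
- by apply/zspanP; exists (fun i => b i + c i); rewrite zcombD.
have /zspanP[b ->] := s_t _ (mem_nth 0 (ltn_ord i)).
by apply/zspanP; exists (fun j => b j * a i); rewrite zcombMz.
Qed.

Lemma zspan_map (V W : zmodType) (f : {additive V -> W}) (s : seq V) w :
  zspan (map f s) w <-> exists2 v, zspan s v & w = f v.
Proof.
split=> [/zspanP[a]|[v /zspanP[a ->] ->]].
  rewrite size_map zcomb_map // => ->; exists (zcomb s (size s) a) => //.
  by apply/zspanP; exists a.
by apply/zspanP; exists a; rewrite size_map zcomb_map.
Qed.

Lemma zfree_map (V W : zmodType) (f : {additive V -> W}) (s : seq V) :
  injective f -> zfree s -> zfree (map f s).
Proof.
move=> inj_f /zfreeP free_s; apply/zfreeP => a.
rewrite size_map zcomb_map // => fa0; apply: free_s.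
by apply: inj_f; rewrite fa0 raddf0.
Qed.

Lemma zfree_of_map (V W : zmodType) (f : {additive V -> W}) (s : seq V) :
  zfree (map f s) -> zfree s.
Proof.
move=> /zfreeP free_s; apply/zfreeP => a a0.
by have:= free_s a; rewrite size_map zcomb_map // a0 raddf0; apply.
Qed.

Lemma zfree_take (V : zmodType) (s : seq V) r : zfree s -> zfree (take r s).
Proof.
move=> /zfreeP free_s; apply/zfreeP => a.
have le_ts: (size (take r s) <= size s)%N by rewrite size_take_min geq_minr.
have le_tr: (size (take r s) <= r)%N by rewrite size_take_min geq_minl.
set m := size _ in le_ts le_tr *.
have ->: zcomb (take r s) m a = zcomb s m a.
  by apply: eq_bigr => i _; rewrite nth_take // (leq_trans _ le_tr).
rewrite -(zcomb_widen _ _ le_ts) => /free_s a0 i lt_im.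
by have:= a0 i (leq_trans lt_im le_ts); rewrite lt_im.
Qed.

(** More than N vectors satisfy a nontrivial rational relation, which becomes
integral after multiplication by the product of the denominators. *)
Lemma zfree_size (N : nat) (s : seq 'rV[rat]_N) : zfree s -> (size s <= N)%N.
Proof.
move=> free_s; rewrite leqNgt; apply/negP => lt_Ns.
pose A := \matrix_(i < size s) s`_i.
have: kermx A != 0.
  by rewrite kermx_eq0 -row_leq_rank -ltnNge (leq_ltn_trans (rank_leq_col A)).
case/rowV0Pn=> u /sub_kermxP uA0 /eqP[]; apply/rowP => i; rewrite mxE.
pose d := \prod_j denq (u 0 j).
have d0: d != 0 by apply/prodf_neq0 => j _; apply: denq_neq0.
pose a j := \prod_(k | k != j) denq (u 0 k) * numq (u 0 j).
have Da j: (a j)%:~R = d%:~R * u 0 j.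
  rewrite /d (bigD1 j) //= /a !intrM numqE; ring.
have/(_ i): forall j, [ffun j => a j] j = 0.
  apply: free_s.
  transitivity (d%:~R *: (u *m A)); last by rewrite uA0 scaler0.
  rewrite mulmx_sum_row scaler_sumr; apply: eq_bigr => j _.
  by rewrite ffunE rowK scalerA -Da scaler_int.
rewrite ffunE => ai0; have:= Da i; rewrite ai0 => /esym/eqP.
by rewrite mulf_eq0 intr_eq0 (negPf d0) => /eqP.
Qed.

(** * Gram-Schmidt orthogonalization *)

Lemma dotC N (u v : 'rV[rat]_N) : dot u v = dot v u.
Proof. by apply: eq_bigr => i _; rewrite mulrC. Qed.

(** The second argument of [dot] comes first here, so that additivity in the
other one can be registered. *)
Definition dotr N (v u : 'rV[rat]_N) : rat := dot u v.

Lemma dotr_is_additive N (v : 'rV[rat]_N) : zmod_morphism (dotr v).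
Proof.
move=> u w; rewrite /dotr /dot -sumrB; apply: eq_bigr => i _.
by rewrite !mxE mulrBl.
Qed.
HB.instance Definition _ N (v : 'rV[rat]_N) :=
  GRing.isZmodMorphism.Build 'rV[rat]_N rat (dotr v) (dotr_is_additive v).

Lemma dotBl N (u w v : 'rV[rat]_N) : dot (u - w) v = dot u v - dot w v.
Proof. exact: (raddfB (dotr v)). Qed.

Lemma dotDl N (u w v : 'rV[rat]_N) : dot (u + w) v = dot u v + dot w v.
Proof. exact: (raddfD (dotr v)). Qed.

Lemma dot_suml N (I : Type) (r : seq I) (F : I -> 'rV[rat]_N) v :
  dot (\sum_(i <- r) F i) v = \sum_(i <- r) dot (F i) v.
Proof. exact: (raddf_sum (dotr v)). Qed.

Lemma dotZl N a (u v : 'rV[rat]_N) : dot (a *: u) v = a * dot u v.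
Proof.
by rewrite /dot mulr_sumr; apply: eq_bigr => i _; rewrite mxE mulrA.
Qed.

Lemma dotMzl N (u v : 'rV[rat]_N) c : dot (u *~ c) v = c%:~R * dot u v.
Proof. by rewrite -scaler_int dotZl. Qed.

Lemma dot_ge0 N (u : 'rV[rat]_N) : 0 <= dot u u.
Proof. by apply: sumr_ge0 => i _; rewrite -expr2 sqr_ge0. Qed.

Lemma dot_eq0 N (u : 'rV[rat]_N) : (dot u u == 0) = (u == 0).
Proof.
apply/eqP/eqP => [u0|->]; last by rewrite /dot big1 // => i _; rewrite mxE mul0r.
apply/rowP => i; rewrite mxE; apply/eqP; rewrite -[_ == 0]orbb -mulf_eq0.
by move/psumr_eq0P: u0 => ->// j _; rewrite -expr2 sqr_ge0.
Qed.

Lemma gram_schmidt_rcons N (s : seq 'rV[rat]_N) v :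
  gram_schmidt (rcons s v) = rcons (gram_schmidt s)
    (v - \sum_(u <- gram_schmidt s) (dot v u / dot u u) *: u).
Proof. exact: foldl_rcons. Qed.

Lemma size_gram_schmidt N (s : seq 'rV[rat]_N) :
  size (gram_schmidt s) = size s.
Proof.
by elim/last_ind: s => // s v IH; rewrite gram_schmidt_rcons !size_rcons IH.
Qed.

(** Every entry of s is a combination of Gram-Schmidt vectors. *)
Lemma orthogonal_gram_schmidt N (s : seq 'rV[rat]_N) z :
  (forall u, u \in gram_schmidt s -> dot u z = 0) ->
  forall u, u \in s -> dot u z = 0.
Proof.
elim/last_ind: s => // s v IH; rewrite gram_schmidt_rcons => z0 u.
have gz0 w: w \in gram_schmidt s -> dot w z = 0.
  by move=> g_w; apply: z0; rewrite mem_rcons inE g_w orbT.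
rewrite mem_rcons inE => /predU1P[->|]; last exact: IH.
have /eqP := z0 (v - \sum_(u <- gram_schmidt s) (dot v u / dot u u) *: u)
  ltac:(by rewrite mem_rcons mem_head); rewrite dotBl dot_suml.
rewrite big_seq big1 ?subr0 => [/eqP//|w g_w].
by rewrite dotZl gz0 ?mulr0.
Qed.

(** Linearly dependent input is allowed: a Gram-Schmidt vector u = 0 contributes
a term with coefficient dot v u / 0 = 0, which does no harm. *)
Lemma gram_schmidt_triangular N (s : seq 'rV[rat]_N) :
  let g := gram_schmidt s in
  [/\ forall i j, (i < j < size s)%N -> dot g`_i g`_j = 0,
      forall i j, (i < j < size s)%N -> dot s`_i g`_j = 0
    & forall i, (i < size s)%N -> dot s`_i g`_i = dot g`_i g`_i].
Proof.
elim/last_ind: s => [|s v /= [orth_g orth_s diag]].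
  by split=> [i j|i j|i]; rewrite ?ltn0 ?andbF.
rewrite gram_schmidt_rcons /=; set g := gram_schmidt s in orth_g orth_s diag *.
set y := v - _; have size_g: size g = size s by apply: size_gram_schmidt.
(* Subtracting the projection on u makes y orthogonal to u, and the projections
   on the other Gram-Schmidt vectors do not change dot u y. *)
have gy u: u \in g -> dot u y = 0.
  move=> g_u; rewrite dotC dotBl dot_suml (big_nth 0) big_mkord.
  have lt_ug: (index u g < size g)%N by rewrite index_mem.
  rewrite (bigD1 (Ordinal lt_ug)) //= nth_index // dotZl big1 ?addr0 => [|i].
    case: (eqVneq u 0) => [->|u0]; last by rewrite divfK ?subrr // dot_eq0.
    by rewrite !(dotC _ 0) -(scale0r 0) !dotZl; ring.
  rewrite -val_eqE /= dotZl => ne_iu.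
  suff ->: dot g`_i u = 0 by rewrite mulr0.
  rewrite -(nth_index 0 g_u); case: (ltngtP i (index u g)) ne_iu => // lt_i _.
    by rewrite orth_g // lt_i -size_g.
  by rewrite dotC orth_g // lt_i -size_g /=.
have sy: forall u, u \in s -> dot u y = 0 by apply: orthogonal_gram_schmidt.
have vy: dot v y = dot y y.
  rewrite [in RHS]/y dotBl -/y dot_suml big_seq big1 ?subr0 // => u g_u.
  by rewrite dotZl gy ?mulr0.
split=> [i j|i j|i]; rewrite size_rcons ltnS !nth_rcons !size_g.
- case/andP=> lt_ij; rewrite leq_eqVlt => /predU1P[Dj|lt_js].
    by rewrite Dj in lt_ij *; rewrite lt_ij ltnn eqxx gy ?mem_nth ?size_g.
  by rewrite lt_js (ltn_trans lt_ij lt_js) orth_g ?lt_ij.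
- case/andP=> lt_ij; rewrite leq_eqVlt => /predU1P[Dj|lt_js].
    by rewrite Dj in lt_ij *; rewrite lt_ij ltnn eqxx sy ?mem_nth.
  by rewrite lt_js (ltn_trans lt_ij lt_js) orth_s ?lt_ij.
rewrite leq_eqVlt => /predU1P[->|lt_is]; first by rewrite ltnn eqxx.
by rewrite lt_is diag.
Qed.

(** The component of the combination v along the Gram-Schmidt vector y of index
r is a r times y, and |a r| >= 1 as a r is a nonzero integer. *)
Lemma dot_gram_schmidt_le N (s : seq 'rV[rat]_N) r a : (r < size s)%N ->
  a r != 0 ->
  dot (gram_schmidt s)`_r (gram_schmidt s)`_r
    <= dot (zcomb s r.+1 a) (zcomb s r.+1 a).
Proof.
move=> lt_rs ar0; have [_ orth diag] := gram_schmidt_triangular s.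
set y := _`_r; set v := zcomb _ _ _.
have vy: dot v y = (a r)%:~R * dot y y.
  rewrite /v zcomb_recr dotDl dotMzl diag // /zcomb dot_suml big1 ?add0r // => i _.
  by rewrite dotMzl orth ?mulr0 // ltn_ord.
(* This is dot v v - (a r)^2 * dot y y >= 0. *)
have:= dot_ge0 (v - y *~ a r); rewrite dotBl dotMzl !(dotC _ (v - _)).
rewrite !dotBl !dotMzl (dotC y v) vy.
have: 1 <= (a r)%:~R ^+ 2 :> rat.
  by rewrite -rmorphXn ler1z -gtz0_ge1 exprn_even_gt0.
have:= dot_ge0 y; set A := _%:~R; nra.
Qed.

(** * Cutting off long Gram-Schmidt vectors *)

Lemma norm2_mono (R : realType) N (u v : 'rV[rat]_N) :
  dot u u <= dot v v -> norm2 R u <= norm2 R v.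
Proof. by move=> le_uv; rewrite ler_wsqrtr // ler_rat. Qed.

(** The condition 0 <= M must appear: for M < 0 no norm is below the bound,
whereas M ^+ 2 is positive. *)
Lemma norm2_leP (R : realType) N (u : 'rV[rat]_N) m (M : rat) : (0 < m)%N ->
  reflect (0 <= M /\ dot u u <= m%:R * M ^+ 2)
          (norm2 R u <= Num.sqrt m%:R * ratr M).
Proof.
move=> m_gt0; have sm_gt0: 0 < Num.sqrt m%:R :> R by rewrite sqrtr_gt0 ltr0n.
have sqM: 0 <= M -> Num.sqrt m%:R * ratr M = Num.sqrt (ratr (m%:R * M ^+ 2)) :> R.
  move=> M0; rewrite rmorphM rmorphXn /= ratr_nat sqrtrM // sqrtr_sqr ger0_norm //.
  by rewrite ler0q.
apply: (iffP idP) => [le_uM|[M0 le_uM]].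
  have M0: 0 <= M.
    by rewrite -(ler0q R) -(pmulr_rge0 _ sm_gt0) (le_trans (sqrtr_ge0 _) le_uM).
  split=> //; rewrite sqM // ler_sqrt ?ler_rat // in le_uM.
  by rewrite ler0q mulr_ge0 // sqr_ge0.
by rewrite sqM // ler_wsqrtr // ler_rat.
Qed.

Lemma cut_index_le (R : realType) N (bound : R) (g : seq 'rV[rat]_N) r :
  (cut_index bound g r <= r)%N.
Proof. by elim: r => //= r IH; case: ifP => // _; apply: leqW. Qed.

Lemma norm2_cut_index (R : realType) N (bound : R) (g : seq 'rV[rat]_N) r k :
  cut_index bound g r = k.+1 -> norm2 R g`_k <= bound.
Proof. by elim: r => //= r IH; case: ltP => // le_rb [<-]. Qed.

(** A short vector has coefficient 0 on each basis vector that is cut off. *)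
Lemma zcomb_cut_index (R : realType) N (bound : R) (s : seq 'rV[rat]_N) r a :
  (r <= size s)%N -> norm2 R (zcomb s r a) <= bound ->
  zcomb s r a = zcomb s (cut_index bound (gram_schmidt s) r) a.
Proof.
elim: r => //= r IH lt_rs short; case: ifP => // gt_bound.
have [ar0|ar0] := eqVneq (a r) 0.
  by rewrite zcomb_recr ar0 mulr0z addr0 in short *; apply: IH => //; apply: ltnW.
have le_gv := norm2_mono R (dot_gram_schmidt_le lt_rs ar0).
by have:= lt_le_trans gt_bound (le_trans le_gv short); rewrite ltxx.
Qed.

(** The last Gram-Schmidt vector that is kept is short, and reducedness compares
all the kept vectors with it. The exponent N bounds the length of s, so the
estimate depends on N, m and M only. *)
Lemma dot_cut_index_le (R : realType) N (s : seq 'rV[rat]_N) m M j :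
  (0 < m)%N -> zfree s -> lll_reduced s ->
  (j < cut_index (Num.sqrt m%:R * ratr M : R) (gram_schmidt s) (size s))%N ->
  dot s`_j s`_j <= 2 ^+ N * (m%:R * M ^+ 2).
Proof.
move=> m0 free_s red_s; set r := cut_index _ _ _.
have := cut_index_le (Num.sqrt m%:R * ratr M : R) (gram_schmidt s) (size s).
rewrite -/r; case Dr: r => [|k] // lt_ks lt_jk.
have /norm2_leP -/(_ m0) [_ gM] := norm2_cut_index Dr.
have /red_s/le_trans-> //: (j <= k < size s)%N by rewrite lt_ks andbT.
apply: ler_pM => //; first by rewrite exprn_ge0.
  exact: dot_ge0.
by rewrite ler_weXn2l ?ler1n // (leq_trans (ltnW lt_ks)) // zfree_size.
Qed.

(** * Integral vectors and their lifts *)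

(** The two entries filled with 0 are overwritten by [refresh]. *)
Definition lift n (w : nat) (xi : 'I_n -> rat[i]) (e : 'rV[int]_n) :
  'rV[rat]_(n + 2) := refresh w xi (row_mx (map_mx intr e) 0).

Lemma lift_is_additive n w (xi : 'I_n -> rat[i]) : zmod_morphism (lift w xi).
Proof.
have sumB (e f : 'rV[int]_n) (y : 'I_n -> rat) :
  w%:R * \sum_i (map_mx intr (e - f)) 0 i * y i =
  w%:R * \sum_i (map_mx intr e) 0 i * y i
    - w%:R * \sum_i (map_mx intr f) 0 i * y i :> rat.
  rewrite -mulrBr -sumrB; congr (_ * _); apply: eq_bigr => i _.
  by rewrite !mxE rmorphB /= mulrBl.
move=> e f; rewrite /lift /refresh !row_mxKl opp_row_mx add_row_mx map_mxB.
congr row_mx; apply/rowP => j; rewrite !mxE -map_mxB.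
by case: j => [[|[|]]] //= _; rewrite sumB.
Qed.
HB.instance Definition _ n w (xi : 'I_n -> rat[i]) :=
  GRing.isZmodMorphism.Build 'rV[int]_n 'rV[rat]_(n + 2) (lift w xi)
    (lift_is_additive w xi).

Lemma epart_lift n w (xi : 'I_n -> rat[i]) : cancel (lift w xi) (@epart n).
Proof.
move=> e; rewrite /epart /lift /refresh !row_mxKl.
by apply/rowP => i; rewrite !mxE numq_int.
Qed.

Definition int_epart n (b : 'rV[rat]_(n + 2)) :=
  lsubmx b = map_mx intr (epart b).

Lemma int_epart_lift n w (xi : 'I_n -> rat[i]) e : int_epart (lift w xi e).
Proof. by rewrite /int_epart epart_lift /lift /refresh !row_mxKl. Qed.

Lemma refresh_epart n w (xi : 'I_n -> rat[i]) b :
  int_epart b -> refresh w xi b = lift w xi (epart b).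
Proof. by move=> Db; rewrite /lift /refresh row_mxKl Db. Qed.

Definition scaled_comb n (w : nat) (y : 'I_n -> rat) (e : 'rV[int]_n) : rat :=
  w%:R * \sum_i (e 0 i)%:~R * y i.

Lemma dot_lift n w (xi : 'I_n -> rat[i]) e :
  dot (lift w xi e) (lift w xi e) = \sum_i (e 0 i)%:~R ^+ 2
    + (scaled_comb w (fun i => complex.Re (xi i)) e ^+ 2
       + scaled_comb w (fun i => complex.Im (xi i)) e ^+ 2).
Proof.
rewrite /dot big_split_ord /=; congr (_ + _).
  by apply: eq_bigr => i _; rewrite row_mxEl row_mxKl mxE expr2.
have cE (y : 'I_n -> rat) : w%:R * \sum_i map_mx intr e 0 i * y i = scaled_comb w y e.
  by congr (_ * _); apply: eq_bigr => i _; rewrite mxE.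
rewrite big_ord_recl big_ord_recl big_ord0 addr0 /=.
by rewrite !row_mxEr !row_mxKl !mxE /= !cE !expr2.
Qed.

(** * Integral relations and their approximations *)

Lemma LplusP (R : realType) n (x : 'I_n -> R[i]) e :
  Lplus x e <-> \sum_i (e 0 i)%:~R * complex.Re (x i) = 0
             /\ \sum_i (e 0 i)%:~R * complex.Im (x i) = 0.
Proof.
have ->: Lplus x e <-> \sum_i (e 0 i)%:~R * x i = 0 by [].
have ->: \sum_i (e 0 i)%:~R * x i =
    (\sum_i (e 0 i)%:~R * complex.Re (x i))
      +i* (\sum_i (e 0 i)%:~R * complex.Im (x i)).
  elim/big_rec3: _ => // i a b z _ ->.
  rewrite -[(e 0 i)%:~R in LHS](rmorph_int (real_complex R)).
  by case: (x i) => u v /=; simpc.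
by split=> [[-> ->]|[-> ->]].
Qed.

(** Each of the n terms has error at most C / (n w), and the sum is multiplied
by w. *)
Lemma scaled_comb_error (R : realType) n w (y : 'I_n -> R) (eta : 'I_n -> rat)
    (e : 'rV[int]_n) (C : R) : (0 < n)%N -> (0 < w)%N ->
  (forall i, `|y i - ratr (eta i)| < ratr (n%:R * w%:R)^-1) ->
  (forall i, `|(e 0 i)%:~R| <= C) ->
  `|w%:R * \sum_i (e 0 i)%:~R * y i - ratr (scaled_comb w eta e)| <= C.
Proof.
move=> n_gt0 w_gt0 near le_eC.
have ->: ratr (scaled_comb w eta e) = w%:R * \sum_i (e 0 i)%:~R * ratr (eta i) :> R.
  rewrite rmorphM rmorph_nat rmorph_sum; congr (_ * _); apply: eq_bigr => i _.
  by rewrite rmorphM /= ratr_int.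
rewrite -mulrBr -sumrB normrM ger0_norm ?ler0n //.
have {}near i : `|y i - ratr (eta i)| <= (n%:R * w%:R)^-1.
  by rewrite (le_trans (ltW (near i))) // fmorphV rmorphM /= !ratr_nat.
have nw_gt0: 0 < n%:R * w%:R :> R by rewrite mulr_gt0 ?ltr0n.
rewrite -ler_pdivlMl ?ltr0n //; apply: le_trans (ler_norm_sum _ _ _) _.
have: forall i, true -> `|(e 0 i)%:~R * y i - (e 0 i)%:~R * ratr (eta i)|
    <= C / (n%:R * w%:R).
  by move=> i _; rewrite -mulrBr normrM ler_pM.
move/ler_sum/le_trans; apply.
rewrite sumr_const card_ord -[X in X <= _]mulr_natl invfM mulrCA !mulrA.
by rewrite mulfK ?pnatr_eq0 -?lt0n // mulrC.
Qed.

(** The vectors e with entries bounded by C are finite in number, so that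
delta can be the least nonzero absolute value of their sums (or 1, if smaller). *)
Lemma small_comb_eq0 (R : realType) n (y : 'I_n -> R) (C : nat) :
  exists2 delta : R, 0 < delta & forall e : 'rV[int]_n,
    (forall i, `|e 0 i| <= C%:Z) -> `|\sum_i (e 0 i)%:~R * y i| < delta ->
    \sum_i (e 0 i)%:~R * y i = 0.
Proof.
(* The entry t i encodes the integer t i - C, which runs from - C to C. *)
pose T := {ffun 'I_n -> 'I_(C + C).+1}.
pose val (t : T) : R := \sum_i ((t i)%:Z - C%:Z)%:~R * y i.
pose delta := \big[Num.min/1]_(t : T | val t != 0) `|val t|.
exists delta => [|e le_eC].
  by apply: (big_ind (fun d => 0 < d)) => [//|a b a0 b0|t t0]; rewrite ?lt_min ?a0 ?normr_gt0.
pose t : T := [ffun i => inord `|e 0 i + C%:Z|].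
have Dt: \sum_i (e 0 i)%:~R * y i = val t.
  apply: eq_bigr => i _; congr (_%:~R * _); rewrite ffunE.
  have:= le_eC i; rewrite ler_norml => /andP[ge_e le_e].
  have e_ge0: 0 <= e 0 i + C%:Z by rewrite -lerBlDr sub0r.
  rewrite inordK; first by rewrite gez0_abs ?addrK.
  by rewrite ltnS -lez_nat gez0_abs // PoszD lerD2r.
rewrite Dt; have [-> //|nz_t] := eqVneq (val t) 0.
by rewrite ltNge /delta (bigD1 t) //= ge_min lexx.
Qed.

Definition approximates (R : realType) n (x : 'I_n -> R[i]) (xi : 'I_n -> rat[i])
    (eps : rat) : Prop :=
  forall i, `|complex.Re (x i) - ratr (complex.Re (xi i))| < ratr eps /\
            `|complex.Im (x i) - ratr (complex.Im (xi i))| < ratr eps.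

(** The n integral entries and the two appended ones are all at most M in
absolute value, whence the factor n + 2. *)
Lemma norm2_lift_le (R : realType) n (x : 'I_n -> R[i]) xi w M e :
  (0 < n)%N -> (0 < w)%N -> approximates x xi (n%:R * w%:R)^-1 ->
  Lplus x e -> (norm_inf e)%:R <= M ->
  norm2 R (lift w xi e) <= Num.sqrt (n + 2)%:R * ratr M.
Proof.
move=> n_gt0 w_gt0 near /LplusP[re0 im0] le_eM.
have e_le i : `|(e 0 i)%:~R| <= M.
  rewrite (le_trans _ le_eM) // -intr_norm -natr_absz ler_nat.
  exact: (@leq_bigmax _ (fun i => `|e 0%R i|%N) i).
have M0: 0 <= M by rewrite (le_trans _ le_eM) // ler0n.
have e_leR i : `|(e 0 i)%:~R| <= ratr M :> R.
  by rewrite -ratr_int -ratr_norm ler_rat.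
have sqr_le (t : rat) : `|t| <= M -> t ^+ 2 <= M ^+ 2.
  by rewrite ler_norml => /andP[]; nra.
have comb_le (y : 'I_n -> R) eta : \sum_i (e 0 i)%:~R * y i = 0 ->
    (forall i, `|y i - ratr (eta i)| < ratr (n%:R * w%:R)^-1) ->
    scaled_comb w eta e ^+ 2 <= M ^+ 2.
  move=> y0 near_y; have := scaled_comb_error n_gt0 w_gt0 near_y e_leR.
  by rewrite y0 mulr0 sub0r normrN -ratr_norm ler_rat => /sqr_le.
apply/norm2_leP; first by rewrite addn2.
split=> //; rewrite dot_lift natrD mulrDl lerD //.
  rewrite mulr_natl -[X in _ *+ X]card_ord -sumr_const.
  by apply: ler_sum => i _; apply: sqr_le.
rewrite mulr_natl mulr2n lerD //.
  by apply: comb_le re0 _ => i; case: (near i).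
by apply: comb_le im0 _ => i; case: (near i).
Qed.

(** With C bounding the entries of the lift, w times the real part of the
relation is within C of an entry that is itself at most C, so that the real
part is at most 2C / w; similarly for the imaginary part. *)
Lemma Lplus_of_dot_lift_le (R : realType) n (x : 'I_n -> R[i]) (D : rat) :
  (0 < n)%N ->
  exists W : nat, forall w xi e, (0 < w)%N -> (W <= w)%N ->
    approximates x xi (n%:R * w%:R)^-1 ->
    dot (lift w xi e) (lift w xi e) <= D -> Lplus x e.
Proof.
move=> n_gt0.
(* The successor makes C >= 1, so that t ^+ 2 <= D < C implies |t| <= C. *)
pose C := (Num.bound `|D|).+1.
have sqr_le (t : rat) : t ^+ 2 <= D -> `|t| <= C%:R.
  move=> le_tD; have: `|t| ^+ 2 < C%:R.
    rewrite -normrX ger0_norm ?sqr_ge0 // (le_lt_trans le_tD) //.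
    apply: le_lt_trans (ler_norm D) _; apply: lt_trans (_ : (Num.bound `|D|)%:R < _).
      exact: archi_boundP.
    by rewrite ltr_nat.
  have: 1 <= C%:R :> rat by rewrite ler1n.
  have:= normr_ge0 t; nra.
have [dRe dRe0 Re0] := small_comb_eq0 (fun i => complex.Re (x i)) C.
have [dIm dIm0 Im0] := small_comb_eq0 (fun i => complex.Im (x i)) C.
exists (maxn (Num.bound ((C + C)%:R / dRe)) (Num.bound ((C + C)%:R / dIm))).
move=> w xi e w_gt0; rewrite geq_max => /andP[leRe leIm] near.
rewrite dot_lift; set s := \sum_i _; set a := scaled_comb _ _ _.
set b := scaled_comb _ _ _ => le_D.
have [s0 a0 b0]: [/\ 0 <= s, 0 <= a ^+ 2 & 0 <= b ^+ 2].
  by split; rewrite ?sqr_ge0 // sumr_ge0 // => i _; rewrite sqr_ge0.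
have e_leQ i : `|(e 0 i)%:~R| <= C%:R :> rat.
  apply: sqr_le; apply: le_trans le_D; rewrite /s (bigD1 i) //= -addrA lerDl.
  by rewrite !addr_ge0 // sumr_ge0 // => j _; rewrite sqr_ge0.
have e_leZ i : `|e 0 i| <= C%:Z.
  by have:= e_leQ i; rewrite -intr_norm -[C%:R]/(C%:Z%:~R) ler_int.
have e_leR i : `|(e 0 i)%:~R| <= C%:R :> R.
  by rewrite -intr_norm -[C%:R]/(C%:Z%:~R) ler_int.
have small (y : 'I_n -> R) eta d : 0 < d ->
    (Num.bound ((C + C)%:R / d) <= w)%N ->
    (forall i, `|y i - ratr (eta i)| < ratr (n%:R * w%:R)^-1) ->
    scaled_comb w eta e ^+ 2 <= D -> `|\sum_i (e 0 i)%:~R * y i| < d.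
  move=> d0 le_w near_y /sqr_le le_c.
  have := scaled_comb_error n_gt0 w_gt0 near_y e_leR.
  set t := \sum_i _; set c := ratr _ => err.
  have {}le_c: `|c| <= C%:R by rewrite -ratr_norm -ratr_nat ler_rat.
  have: (C + C)%:R / d < w%:R.
    apply: lt_le_trans (_ : (Num.bound ((C + C)%:R / d))%:R <= _).
      by rewrite archi_boundP // divr_ge0 ?ler0n // ltW.
    by rewrite ler_nat.
  rewrite ltr_pdivrMr // natrD => lt_w.
  rewrite -(ltr_pM2l (_ : 0 < w%:R)) ?ltr0n // -{1}[w%:R]ger0_norm ?ler0n // -normrM.
  apply: le_lt_trans lt_w; rewrite -[w%:R * t](subrK c).
  by apply: le_trans (ler_normD _ _) _; rewrite lerD.
apply/LplusP; split.
  apply: Re0 => //; apply: (small _ (fun i => complex.Re (xi i)) _ dRe0 leRe) => [i|].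
    by case: (near i).
  by apply: le_trans le_D; rewrite -/a; lra.
apply: Im0 => //; apply: (small _ (fun i => complex.Im (xi i)) _ dIm0 leIm) => [i|].
    by case: (near i).
by apply: le_trans le_D; rewrite -/b; lra.
Qed.

Lemma zspan_Lplus (R : realType) n (x : 'I_n -> R[i]) s e :
  (forall u, u \in s -> Lplus x u) -> zspan s e -> Lplus x e.
Proof.
move=> sL /zspanP[a ->]; rewrite /Lplus /zcomb.
under eq_bigr => i _ do rewrite summxE rmorph_sum mulr_suml.
rewrite exchange_big big1 // => j _.
have Lj: \sum_i (s`_j 0 i)%:~R * x i = 0 := sL _ (mem_nth 0 (ltn_ord j)).
transitivity ((\sum_i (s`_j 0 i)%:~R * x i) *~ a j); last by rewrite Lj mul0rz.
rewrite mulrz_suml; apply: eq_bigr => i _.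
by rewrite -scaler_int mxE intz rmorphM /= -mulrA mulrzl.
Qed.

(** * Correctness of the loop *)

Section Loop.

Variables (R : realType) (n : nat) (x : 'I_n -> R[i]).
Variables (approx : rat -> {ffun 'I_n -> rat[i]}) (M : rat).
Variables (inL : 'rV[int]_n -> bool).
Variables (lll : seq 'rV[rat]_(n + 2) -> seq 'rV[rat]_(n + 2)).
Hypothesis n_gt0 : (0 < n)%N.
Hypothesis approxP : forall eps, 0 < eps -> approximates x (approx eps) eps.
Hypothesis short_basis :
  exists s, is_zbasis (Lplus x) s /\ (forall b, b \in s -> (norm_inf b)%:R <= M).
Hypothesis inLP : forall b, Lplus x b <-> inL b.
Hypothesis lllP : lll_spec lll.

(** The last two entries are left arbitrary, since [refresh] recomputes them from
the integral parts. *)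
Definition loop_inv (B : seq 'rV[rat]_(n + 2)) : Prop :=
  [/\ forall b, b \in B -> int_epart b, zfree (map (@epart n) B)
    & forall e, Lplus x e -> zspan (map (@epart n) B) e].

Lemma is_zbasis_map_epart B : loop_inv B ->
  (forall b, b \in B -> Lplus x (epart b)) ->
  is_zbasis (Lplus x) (map (@epart n) B).
Proof.
case=> _ free_B sub_B BL; split=> // e; split; first exact: sub_B.
by apply: zspan_Lplus => u /mapP[b B_b ->]; apply: BL.
Qed.

(** LLL keeps the lattice, so its output again consists of lifts, taken with the
same w and xi. *)
Lemma lll_refresh w (xi : 'I_n -> rat[i]) B : loop_inv B ->
  let b := lll (map (refresh w xi) B) in
  [/\ b = map (lift w xi) (map (@epart n) b), zfree b, lll_reduced b
    & forall e, Lplus x e -> zspan b (lift w xi e)].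
Proof.
case=> int_B free_B sub_B; set E := map (@epart n) B in free_B sub_B.
have ->: map (refresh w xi) B = map (lift w xi) E.
  by rewrite -map_comp; apply/eq_in_map => b /int_B/refresh_epart->.
have [|[free_b span_b] red_b] := lllP (B := map (lift w xi) E).
  exact: (zfree_map (can_inj (epart_lift w xi))).
move=> b; split=> // [|e Le].
  rewrite -map_comp -[LHS]map_id; apply/eq_in_map => v /zspan_mem/span_b/zspan_map.
  by case=> e _ -> /=; rewrite epart_lift.
by apply/span_b/(zspan_map (lift w xi)); exists e; first exact: sub_B.
Qed.

Lemma approximates_loop w : (0 < w)%N ->
  approximates x (approx (n%:R * w%:R)^-1) (n%:R * w%:R)^-1.
Proof. by move=> w_gt0; apply: approxP; rewrite invr_gt0 mulr_gt0 ?ltr0n. Qed.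

Lemma loop_inv_body w B : (0 < w)%N -> loop_inv B ->
  loop_inv (loop_body R approx lll M w B).
Proof.
move=> w_gt0 inv_B; have near := approximates_loop w_gt0.
rewrite /loop_body; set xi := approx _ in near *; set bound := _ * _.
have [] := lll_refresh w xi inv_B.
set b := lll _ => Db free_b _ span_b; set r := cut_index _ _ _.
have inj_lift: injective (lift w xi) := can_inj (epart_lift w xi).
have le_rb: (r <= size b)%N := cut_index_le _ _ _.
split=> [v /mem_take| | ].
- by rewrite Db => /mapP[e _ ->]; apply: int_epart_lift.
- rewrite map_take; apply: zfree_take.
  by rewrite Db in free_b; apply: zfree_of_map free_b.
have [s [[_ span_s] s_leM]] := short_basis.
move=> e /span_s; apply: zspan_trans => {}e s_e.
have Le: Lplus x e by apply/span_s/zspan_mem.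
have /zspanP[a De] := span_b _ Le.
have := norm2_lift_le n_gt0 w_gt0 near Le (s_leM _ s_e).
rewrite De => /(zcomb_cut_index (leqnn _)); rewrite -De -/r {1}Db.
rewrite zcomb_map ?size_map // => /inj_lift->; apply/zspanP; exists a.
by rewrite map_take size_takel ?size_map // zcomb_take.
Qed.

Lemma Lplus_loop_body : exists W : nat, forall w B,
  (0 < w)%N -> (W <= w)%N -> loop_inv B ->
  forall v, v \in loop_body R approx lll M w B -> Lplus x (epart v).
Proof.
have [W WP] := Lplus_of_dot_lift_le x
  (2 ^+ (n + 2) * ((n + 2)%:R * M ^+ 2)) n_gt0.
exists W => w B w_gt0 le_Ww inv_B; have near := approximates_loop w_gt0.
rewrite /loop_body; set xi := approx _ in near *; set bound := _ * _.
have [] := lll_refresh w xi inv_B.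
set b := lll _ => Db free_b red_b _ v /(nthP 0)[j].
rewrite size_take_min ltn_min => /andP[lt_jr lt_jb] <-.
rewrite nth_take //; apply: (WP w xi) => //.
have ->: lift w xi (epart b`_j) = b`_j.
  have /mapP[e _ ->]: b`_j \in map (lift w xi) (map (@epart n) b).
    by rewrite -Db mem_nth.
  by rewrite epart_lift.
by apply: dot_cut_index_le lt_jr; rewrite ?addn2.
Qed.

(** The threshold W is where the integral parts are known to lie in L_+: since w
doubles at each iteration, the loop stops once w >= W. *)
Lemma run_loop_correct W fuel w B :
  (forall w' B', (0 < w')%N -> (W <= w')%N -> loop_inv B' ->
     forall v, v \in loop_body R approx lll M w' B' -> Lplus x (epart v)) ->
  (0 < w)%N -> loop_inv B ->
  ((W <= w)%N -> forall v, v \in B -> Lplus x (epart v)) ->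
  (W <= w * 2 ^ fuel)%N ->
  exists out, run_loop R approx inL lll M fuel w B = Some out
           /\ is_zbasis (Lplus x) out.
Proof.
move=> WP; elim: fuel w B => [|fuel IH] w B w_gt0 inv_B BL le_W /=.
  have BL1: forall v, v \in B -> Lplus x (epart v) by apply: BL; rewrite -[w]muln1.
  have /hasPn/negPf->: forall v, v \in B -> ~~ ~~ inL (epart v).
    by move=> v /BL1/inLP ->.
  by exists (map (@epart n) B); split=> //; apply: is_zbasis_map_epart.
case: ifPn => [_ | /hasPn inB].
  apply: IH => [||le_W2|]; first by rewrite muln_gt0.
  - by apply: loop_inv_body; rewrite ?muln_gt0.
  - by apply: WP; rewrite ?muln_gt0.
  by rewrite -mulnA mulnCA -expnS.
exists (map (@epart n) B); split=> //; apply: is_zbasis_map_epart => // b B_b.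
by apply/inLP; rewrite -[inL _]negbK; apply: inB.
Qed.

(** The integral parts are the unit vectors, which form a basis of Z^n. *)
Lemma loop_inv_initial : loop_inv (initial_vectors n).
Proof.
have lsub_delta i :
    lsubmx (delta_mx 0 (lshift 2 i)) = map_mx intr (delta_mx 0 i) :> 'rV[rat]_n.
  by apply/rowP => j; rewrite !mxE (inj_eq (@lshift_inj _ _)); case: (_ && _).
have epart_delta i : @epart n (delta_mx 0 (lshift 2 i)) = delta_mx 0 i.
  by apply/rowP => j; rewrite /epart lsub_delta !mxE numq_int.
have DE: map (@epart n) (initial_vectors n) = [seq delta_mx 0 i | i <- enum 'I_n].
  by rewrite -map_comp; apply: eq_map => i; apply: epart_delta.
have size_E: size [seq delta_mx 0 i : 'rV[int]_n | i <- enum 'I_n] = n.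
  by rewrite size_map size_enum_ord.
have combE a : zcomb [seq delta_mx 0 i : 'rV[int]_n | i <- enum 'I_n] n a
    = \row_i a i.
  apply/rowP => j; rewrite /zcomb summxE (bigD1 j) //= big1 => [|i ne_ij].
    rewrite (nth_map j) ?size_enum_ord // nth_ord_enum addr0.
    by rewrite -scaler_int !mxE !eqxx mulr1 intz.
  rewrite (nth_map j) ?size_enum_ord // nth_ord_enum.
  by rewrite -scaler_int !mxE eqxx eq_sym (negPf ne_ij) mulr0.
split; rewrite ?DE.
- by move=> b /mapP[i _ ->]; rewrite /int_epart epart_delta lsub_delta.
- apply/zfreeP => a; rewrite size_E combE => /rowP a0 i lt_in.
  by have:= a0 (Ordinal lt_in); rewrite !mxE.
move=> e _; apply/zspanP; rewrite size_E.
have [a Da] := ffun_ext_nat 0 [ffun i => e 0 i].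
by exists a; rewrite combE; apply/rowP => i; rewrite mxE Da ffunE.
Qed.

Lemma lattice_algorithm_correct : exists fuel out,
  lattice_algorithm R approx inL lll M fuel = Some out /\ is_zbasis (Lplus x) out.
Proof.
have [W WP] := Lplus_loop_body.
(* A threshold greater than 1 makes the claim about vectors that have not yet
   gone through the loop body vacuous, as w = 1 initially; the fuel W.+2 is
   enough because W.+2 < 2 ^ W.+2. *)
exists W.+2; apply: (@run_loop_correct W.+2) loop_inv_initial _ _ => //.
  by move=> w B w_gt0 /ltnW/ltnW; apply: WP.
by rewrite mul1n ltnW // ltn_expl.
Qed.

End Loop.

Theorem theorem5 (R : realType) (n : nat) (hn : (1 <= n)%N)
    (x : 'I_n -> R[i]) (hx0 : forall i, x i != 0)
    (approx : rat -> {ffun 'I_n -> rat[i]}) (hx : computes_numbers x approx)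
    (M : rat)
    (hM : exists s : seq 'rV[int]_n,
        is_zbasis (Lplus x) s /\ (forall b, b \in s -> (norm_inf b)%:R <= M))
    (inL : 'rV[int]_n -> bool) (hL : decides (Lplus x) inL)
    (lll : seq 'rV[rat]_(n + 2) -> seq 'rV[rat]_(n + 2))
    (hlll : lll_spec lll) :
  exists (fuel : nat) (out : seq 'rV[int]_n),
    lattice_algorithm R approx inL lll M fuel = Some out /\
    is_zbasis (Lplus x) out.
Proof.
case: hx hL => _ approxP [_ inLP].
apply: lattice_algorithm_correct => // eps eps_gt0 i; exact: approxP.
Qed.
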